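(* Let $M\subseteq\mathbb{T}$ satisfy the standing hypothesis, let $M^*=M\cup\curvearrowleft M$, and let $\mathrm{TT}$ be the set of trace transformers $\{\boldsymbol{\sigma}_S\}_{S\subseteq\mathbb{S}}\cup\{\boldsymbol{\pi}_t\}_{t\subseteq\mathbb{S}\times\mathbb{S}}\cup\{\oplus,\cup,\neg,\curvearrowleft\}\cup\{\lambda X.\boldsymbol{\forall}(N,X)\}_{N\subseteq M^*}$. Then the complete shell of $\rho^\forall_M$ for $\mathrm{TT}$ exists and equals $\lambda X.\,X\cap M^*$, whose set of fixpoints is $\{X\subseteq\mathbb{T}\mid X\subseteq M^*\}$.
   Context: $\mathbb{T}$ is the set of traces $\langle i,\sigma\rangle$, $i\in\mathbb{Z}$, $\sigma:\mathbb{Z}\to\mathbb{S}$; $X_{\downarrow s}=\{\langle i,\sigma\rangle\in X\mid\sigma_i=s\}$; $\neg X=\mathbb{T}\setminus X$; $\oplus(X)=\{\langle i,\sigma\rangle\mid\langle i+1,\sigma\rangle\in X\}$, $\ominus(X)=\{\langle i,\sigma\rangle\mid\langle i-1,\sigma\rangle\in X\}$, $\curvearrowleft(X)=\{\langle -i,\lambda k.\sigma_{-k}\rangle\mid\langle i,\sigma\rangle\in X\}$; $\cup$ is binary union; the constants $\boldsymbol{\sigma}_S=\{\langle i,\sigma\rangle\mid\sigma_i\in S\}$ and $\boldsymbol{\pi}_t=\{\langle i,\sigma\rangle\mid(\sigma_i,\sigma_{i+1})\in t\}$ are 0-ary transformers; $\boldsymbol{\forall}(N,X)=\{\langle i,\sigma\rangle\in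 N\mid N_{\downarrow\sigma_i}\subseteq X\}$. Standing hypothesis on $M$: (i) $|M_{\downarrow s}|>1$ for all $s$; (ii) $\oplus(M)=M=\ominus(M)$ and $\oplus(\curvearrowleft M)=\curvearrowleft M=\ominus(\curvearrowleft M)$. $\rho^\forall_M(X)=\{\langle i,\sigma\rangle\in M\mid M_{\downarrow\sigma_i}\subseteq X\}$. Upper closure operators on $\langle\wp(\mathbb{T}),\supseteq\rangle$: maps monotone w.r.t. $\subseteq$, idempotent, with $\rho(X)\subseteq X$; $\rho\sqsubseteq\eta$ iff $\rho(X)\supseteq\eta(X)$ for all $X$. $\rho$ is complete for an $n$-ary $f$ if $\rho(f(X_1,\dots,X_n))=\rho(f(\rho(X_1),\dots,\rho(X_n)))$ for all $X_1,\dots,X_n$ (trivial for $n=0$). The complete shell of $\rho$ for a set $F$ of functions is the $\sqsubseteq$-greatest closure $\eta\sqsubseteq\rho$ complete for every $f\in F$. *)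

(* Defs.v *)
From mathcomp Require Import all_boot all_order all_algebra.
From mathcomp Require Import boolp classical_sets.

Set Implicit Arguments.
Unset Strict Implicit.
Unset Printing Implicit Defensive.

Local Open Scope classical_set_scope.
Local Open Scope ring_scope.

Section Traces.
Variable S : Type.

(* The pair (i, sigma) is the trace with present time i. *)
Definition trace : Type := (int * (int -> S))%type.

Implicit Types (M N X Y : set trace) (rho eta : set trace -> set trace).

Definition present (x : trace) : S := x.2 x.1.

Definition at_state X (s : S) : set trace := [set x | X x /\ present x = s].

Definition next_op X : set trace := [set x | X (x.1 + 1, x.2)].

Definition prev_op X : set trace := [set x | X (x.1 - 1, x.2)].

Definition rev_trace (x : trace) : trace := (- x.1, fun k => x.2 (- k)).

Definition reversal X : set trace := rev_trace @` X.

Definition state_traces (A : set S) : set trace := [set x | A (present x)].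

Definition trans_traces (t : set (S * S)) : set trace :=
  [set x | t (x.2 x.1, x.2 (x.1 + 1))].

Definition univ N X : set trace :=
  [set x | N x /\ at_state N (present x) `<=` X].

Definition standing_hyp M : Prop :=
  [/\ forall s : S,
        exists x y, [/\ at_state M s x, at_state M s y & x <> y],
      next_op M = M /\ M = prev_op M &
      next_op (reversal M) = reversal M /\ reversal M = prev_op (reversal M)].

Definition star M : set trace := M `|` reversal M.

Definition rho_univ M X : set trace :=
  [set x | M x /\ at_state M (present x) `<=` X].

(* Upper closures with respect to reverse inclusion on sets of traces, hence the
   contraction [rho X `<=` X]. *)
Definition uco rho : Prop :=
  [/\ forall X Y, X `<=` Y -> rho X `<=` rho Y,
      forall X, rho (rho X) = rho X &
      forall X, rho X `<=` X].

Definition uco_le rho eta : Prop := forall X, eta X `<=` rho X.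

Record transformer := Transformer {
  arity : nat;
  apply_tr : ('I_arity -> set trace) -> set trace }.

Arguments apply_tr : clear implicits.

Definition nullary (A : set trace) : transformer :=
  @Transformer 0 (fun=> A).

Definition unary (f : set trace -> set trace) : transformer :=
  @Transformer 1 (fun Xs => f (Xs ord0)).

Definition binary (f : set trace -> set trace -> set trace) : transformer :=
  @Transformer 2 (fun Xs => f (Xs ord0) (Xs ord_max)).

Definition complete_for rho (f : transformer) : Prop :=
  forall Xs : 'I_(arity f) -> set trace,
    rho (apply_tr f Xs) = rho (apply_tr f (fun i => rho (Xs i))).

Definition is_complete_shell (F : set transformer) rho eta : Prop :=
  [/\ uco eta,
      uco_le eta rho,
      forall f, F f -> complete_for eta f &
      forall eta', uco eta' -> uco_le eta' rho ->
        (forall f, F f -> complete_for eta' f) -> uco_le eta' eta].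

Definition TT M : set transformer :=
  [set nullary (state_traces A) | A in [set: set S]]
  `|` [set nullary (trans_traces t) | t in [set: set (S * S)]]
  `|` [set unary next_op; binary setU; unary setC; unary reversal]
  `|` [set unary (univ N) | N in [set N | N `<=` star M]].

End Traces.

(* Main.v *)
Require Import Defs.
From mathcomp Require Import all_boot all_order all_algebra.
From mathcomp Require Import boolp classical_sets.

Local Open Scope classical_set_scope.

(** Let [eta] be a closure below [rho_univ M].  Completeness for complement
    forces [x \in eta {x}] for [x \in M]: otherwise [eta {x}] is empty, so
    [eta (~ {x}) = eta T], which contains [rho_univ M T = M], although
    [eta (~ {x})] avoids [x].  Completeness for reversal transports this to the
    reversal of [M], and monotonicity gives [X `&` star M `<=` eta X].
    Conversely [star M] is invariant under shift and reversal, so intersecting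
    with it is complete for every transformer. *)

Lemma rev_traceK (S : Type) : involutive (@rev_trace S).
Proof.
move=> [i s]; rewrite /rev_trace /= GRing.opprK; congr pair.
by apply/funext => k; rewrite GRing.opprK.
Qed.

(** As [rev_trace] is an involution, image and preimage under it coincide. *)
Lemma reversalE (S : Type) (X : set (trace S)) x :
  reversal X x = X (rev_trace x).
Proof.
apply/propext; split=> [[y Xy <-]|Xx]; first by rewrite rev_traceK.
by exists (rev_trace x); rewrite ?rev_traceK.
Qed.

Lemma reversal_star (S : Type) (M : set (trace S)) :
  reversal (star M) = star M.
Proof.
apply/seteqP; split=> x; rewrite reversalE /star /setU /= !reversalE rev_traceK;
  by case; [right|left].
Qed.

Lemma next_op_star (S : Type) (M : set (trace S)) :
  standing_hyp M -> next_op (star M) = star M.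
Proof.
case=> _ [nM _] [nR _].
(* [next_op] is a preimage, so it distributes over the union by conversion. *)
by rewrite -[LHS]/(next_op M `|` next_op (reversal M)) nM nR.
Qed.

Lemma uco_le_anti (S : Type) (rho eta : set (trace S) -> set (trace S)) :
  uco_le rho eta -> uco_le eta rho -> rho = eta.
Proof. by move=> re er; apply/funext => X; apply/seteqP; split. Qed.

Lemma complete_shell_uniq (S : Type) (F : set (transformer S)) rho eta eta' :
  is_complete_shell F rho eta -> is_complete_shell F rho eta' -> eta = eta'.
Proof.
move=> [u l c g] [u' l' c' g'].
by apply: uco_le_anti; [apply: g'|apply: g].
Qed.

Lemma uco_setI (S : Type) (A : set (trace S)) : uco (fun X => X `&` A).
Proof.
split=> [X Y XY|X|X]; first exact: setSI.
- by rewrite -setIA setIid.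
- exact: subIsetl.
Qed.

Lemma setI_star_complete (S : Type) (M : set (trace S)) f :
  standing_hyp M -> TT M f -> complete_for (fun X => X `&` star M) f.
Proof.
move=> hM TTf; case: TTf => [[[[A _ <-]|[t _ <-]]|[[[->|->]|->]|->]]|] //.
(* Duplicate [star M] and view one copy as its own shift, which then merges with the argument by
   conversion. *)
- move=> Xs /=; rewrite -[in LHS](setIid (star M)) -{1}(next_op_star _ M hM).
  by rewrite setIA.
(* Cutting the argument adds to its complement only traces outside [star M], which the outer
   intersection discards. *)
- by move=> Xs /=; rewrite !setIUl -!setIA !setIid.
- by move=> Xs /=; rewrite setCI setIUl setICl setU0.
- move=> Xs /=; apply/seteqP; split=> x [] /=; rewrite !reversalE.
    move=> Xx Mx; split=> //; split=> //.
    by rewrite -reversal_star reversalE rev_traceK.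
  by case=> Xx _ Mx; split.
(* [univ N] tests inclusion only for traces of [N], and these all lie in [star M]. *)
- case=> N NM <- Xs /=; congr (_ `&` _).
  apply/seteqP; split=> x [Nx NX]; split=> // y Ny; last by case: (NX y Ny).
  by split; [exact: NX|case: Ny => /NM].
Qed.

Lemma rho_univT (S : Type) (M : set (trace S)) : rho_univ M setT = M.
Proof. by apply/seteqP; split=> x // -[]. Qed.

Lemma setC_complete_singleton (S : Type) (M : set (trace S)) eta x :
  uco eta -> uco_le eta (rho_univ M) -> complete_for eta (unary setC) ->
  M x -> eta [set x] x.
Proof.
move=> [_ _ dec] le cC Mx; apply: contrapT => nx.
have e0 : eta [set x] = set0.
  by rewrite -subset0 => y ey; apply: nx; have yx := dec _ _ ey; rewrite -{2}yx.
have /= := cC (fun=> [set x]); rewrite e0 setC0 => eC.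
have : eta (~` [set x]) x by rewrite eC; apply: le; rewrite rho_univT.
by move/dec; apply.
Qed.

(** Completeness at [[set x]] gives [eta [set rev_trace x] = eta (reversal (eta [set x]))]; by
    contraction [rev_trace x] lies in the reversal of [eta [set x]]. *)
Lemma reversal_complete_singleton (S : Type) (eta : set (trace S) -> set (trace S)) x :
  uco eta -> complete_for eta (unary (@reversal S)) ->
  eta [set rev_trace x] (rev_trace x) -> eta [set x] x.
Proof.
move=> [_ _ dec] cR ex.
have /= eR := cR (fun=> [set x]).
have : eta (reversal [set x]) (rev_trace x).
  by rewrite /reversal image_set1.
by rewrite eR => /dec; rewrite reversalE rev_traceK.
Qed.

Lemma complete_le_setI_star (S : Type) (M : set (trace S)) eta :
  uco eta -> uco_le eta (rho_univ M) -> complete_for eta (unary setC) ->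
  complete_for eta (unary (@reversal S)) -> uco_le eta (fun X => X `&` star M).
Proof.
move=> u le cC cR X x [Xx Mx]; have [mono _ _] := u.
apply: (mono [set x]); first by move=> y ->.
case: Mx => [Mx|]; first exact: setC_complete_singleton Mx.
rewrite reversalE => Mx; apply: reversal_complete_singleton => //.
exact: setC_complete_singleton Mx.
Qed.

Lemma setI_star_complete_shell (S : Type) (M : set (trace S)) :
  standing_hyp M ->
  is_complete_shell (TT M) (rho_univ M) (fun X => X `&` star M).
Proof.
move=> hM; split; first exact: uco_setI.
(* A trace [x] of [M] belongs to [at_state M (present x)], so [MX] applies to [x] itself. *)
- by move=> X x [Mx MX]; split; [exact: MX|left].
- by move=> f; apply: setI_star_complete.
- move=> eta u le c; apply: complete_le_setI_star => //; apply: c; left; right.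
  + by left; right.
  + by right.
Qed.

Theorem theorem15 (S : Type) (M : set (trace S)) (hM : standing_hyp M) :
  [/\ is_complete_shell (TT M) (rho_univ M) (fun X => X `&` star M),
      forall eta : set (trace S) -> set (trace S),
        is_complete_shell (TT M) (rho_univ M) eta ->
        eta = (fun X => X `&` star M) &
      [set X : set (trace S) | X `&` star M = X] =
      [set X : set (trace S) | X `<=` star M]].
Proof.
have sh := setI_star_complete_shell _ M hM.
split=> // [eta he|]; first exact: complete_shell_uniq he sh.
by apply/funext => X; apply/propext; split=> /= /setIidPl.
Qed.
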